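(* Let $N\ge 2$ be an integer. For every $0<\epsilon<1$, let $$\alpha_{\epsilon}=\frac{1}{N}(1-\epsilon)\quad\text{and}\quad m_{\epsilon}=\frac{N(N-1)\epsilon^2}{1+(N-1)\epsilon^2}.$$ Then the following inclusion of cones in $\mathbb{R}^N$ holds: $$\overline{\Gamma}^{+}_{2}(\alpha_{\epsilon})\subset \overline{\mathcal{P}}_{m_{\epsilon}}.$$ Moreover, for every vector $V=(\mu_{1},\dots,\mu_{N})\in \overline{\Gamma}^{+}_{2}(\alpha_{\epsilon})$ with $\mu_{1}\leq\cdots\leq\mu_{N}$ and $\overline{\mu}:=\sum_{i=1}^{N}\mu_{i}>0$, one of the following holds: (1) $\mu_{1}+\cdots+\mu_{\lfloor m_{\epsilon}\rfloor}+\big(m_{\epsilon}-\lfloor m_{\epsilon}\rfloor\big)\mu_{\lfloor m_{\epsilon}\rfloor+1}> 0$; (2) $m_{\epsilon}$ is a positive integer, $\mu_{1}=\mu_{2}=\cdots=\mu_{m_{\epsilon}}=0$, and $\mu_{m_{\epsilon}+1}=\mu_{m_{\epsilon}+2}=\cdots=\mu_{N}>0$.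
   Context: For $V=(\mu_1,\dots,\mu_N)\in\mathbb{R}^N$ let $\sigma_j(V)=\sum_{1\le i_1<\cdots<i_j\le N}\mu_{i_1}\cdots\mu_{i_j}$. The Gårding cone is $\Gamma_k^+=\{V\in\mathbb{R}^N:\sigma_j(V)>0\text{ for all }j=1,\dots,k\}$. For $\alpha\ge 0$ put $V_\alpha=V-\alpha\overline{\mu}\,(1,\dots,1)$ with $\overline{\mu}=\sum_{i=1}^N\mu_i$, and define $\Gamma_k^+(\alpha)=\{V\in\mathbb{R}^N: V_\alpha\in\Gamma_k^+\}$; $\overline{\Gamma}_k^+(\alpha)$ is its closure in $\mathbb{R}^N$. For a real number $0<m<N$, $\mathcal{P}_m$ is the set of $V=(\mu_1,\dots,\mu_N)\in\mathbb{R}^N$ such that $\mu_{i_1}+\cdots+\mu_{i_{\lfloor m\rfloor}}+(m-\lfloor m\rfloor)\mu_{i_{\lfloor m\rfloor+1}}>0$ for all pairwise distinct indices $i_1,\dots,i_{\lfloor m\rfloor+1}\in\{1,\dots,N\}$ (equivalently, the inequality holds with the entries of $V$ arranged in nondecreasing order and the first $\lfloor m\rfloor+1$ of them used in that order). $\overline{\mathcal{P}}_m$ is its closure. Here $\lfloor c\rfloor$ is the largest integer not exceeding $c$, and an empty sum is $0$. *)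

(* Defs.v *)
From HB Require Import structures.
From mathcomp Require Import all_boot all_order all_algebra.
From mathcomp Require Import all_classical all_reals all_analysis.

Set Implicit Arguments.
Unset Strict Implicit.
Unset Printing Implicit Defensive.

Import Order.TTheory GRing.Theory Num.Theory.
Import numFieldNormedType.Exports.

Local Open Scope classical_set_scope.
Local Open Scope ring_scope.

(* Tuples i_1 < ... < i_j are encoded by the sets of indices of size j. *)
Definition sigma (R : realType) (N j : nat) (V : 'rV[R]_N) : R :=
  \sum_(A : {set 'I_N} | #|A| == j) \prod_(i in A) V 0 i.

Definition Garding_cone (R : realType) (N k : nat) : set 'rV[R]_N :=
  [set V | forall j : nat, (1 <= j <= k)%N -> 0 < sigma j V].
Arguments Garding_cone {R} N k.

(* In the paper mu-bar is the sum of the entries, not their average. *)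
Definition mubar (R : realType) (N : nat) (V : 'rV[R]_N) : R :=
  \sum_(i < N) V 0 i.

Definition Valpha (R : realType) (N : nat) (alpha : R) (V : 'rV[R]_N) :
    'rV[R]_N :=
  V - const_mx (alpha * mubar V).

Definition Garding_cone_alpha (R : realType) (N k : nat) (alpha : R) :
    set 'rV[R]_N :=
  [set V | Garding_cone N k (Valpha alpha V)].
Arguments Garding_cone_alpha {R} N k alpha.

(* Meant for 0 < m < N: there [Num.truncn m] is the floor of m, and injections
   from 'I_(floor m).+1 to 'I_N exist. The index f ord_max, which carries the
   fractional weight, plays the role of i_(floor m + 1). *)
Definition Pcone (R : realType) (N : nat) (m : R) : set 'rV[R]_N :=
  [set V | forall f : 'I_(Num.truncn m).+1 -> 'I_N, injective f ->
     0 < \sum_(j < Num.truncn m) V 0 (f (widen_ord (leqnSn _) j))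
         + (m - (Num.truncn m)%:R) * V 0 (f ord_max)].
Arguments Pcone {R} N m.

(* [entry V k] is mu_(k+1); the value 0 is a dummy for k >= N. *)
Definition entry (R : realType) (N : nat) (V : 'rV[R]_N) (k : nat) : R :=
  oapp (V 0) 0 (insub k : option 'I_N).

(* Main.v *)
Require Import Defs.
From HB Require Import structures.
From mathcomp Require Import all_boot all_order all_algebra.
From mathcomp Require Import all_classical all_reals all_analysis.
From mathcomp Require Import ring lra.

Import Order.TTheory GRing.Theory Num.Theory.
Import numFieldNormedType.Exports.

Local Open Scope classical_set_scope.
Local Open Scope ring_scope.

(** Write s = mu_1 + ... + mu_N, q = mu_1^2 + ... + mu_N^2 and
    d = N - m_eps, so that d = N / (1 + (N-1) eps^2). As
    2 sigma_2 = sigma_1^2 - q, both conditions defining Gamma_2(alpha_eps) can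
    be rewritten in terms of s and q, and the cone turns out to be the round
    cone s > 0, d q < s^2 ([Garding_cone_alpha_sum_sqr]). By continuity, its
    closure satisfies d q <= s^2.

    The sum in the definition of P_m is sum_i w_i mu_i, where the weights w_i
    lie in [0, 1] and have sum m. Put u = 1 - w, a vector with entries in
    [0, 1] and sum d. Then |u|^2 <= sum_i u_i = d, and Cauchy-Schwarz gives
        s - sum_i w_i mu_i = <u, mu> <= |u| |mu| <= sqrt (d q) <= s,
    so the weighted sum is nonnegative, and positive when d q < s^2. Taking
    closures gives the inclusion of cones.

    If the weighted sum vanishes while s > 0, all these inequalities are
    equalities. From |u|^2 = d every weight is 0 or 1, so m is an integer;
    equality in Cauchy-Schwarz makes mu proportional to u, that is, 0 on the m
    selected indices and constant on the others.

    The inequalities and their equality cases are obtained together from one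
    exact identity, with c = s / d and r the fractional part of m:
        |mu - c u|^2 + c^2 r (1 - r) = 2 c sum_i w_i mu_i + (q - s^2 / d)
    ([selected_sum_identity]). On the left stands a sum of nonnegative defects,
    and the last term on the right is nonpositive on the closed cone. *)

(** Cauchy-Schwarz with its defect made explicit: expand |v - c u|^2, and use
    that u_i^2 = u_i - (1 - u_i) u_i has sum d minus the second term. *)
Lemma sum_sqr_sub_scaled (R : realFieldType) (I : finType) (u v : I -> R)
    (d : R) : d != 0 -> \sum_i u i = d ->
  let c := (\sum_i v i) / d in
  \sum_i (v i - c * u i) ^+ 2 + c ^+ 2 * \sum_i (1 - u i) * u i
  = 2 * c * \sum_i (1 - u i) * v i
    + (\sum_i v i ^+ 2 - (\sum_i v i) ^+ 2 / d).
Proof.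
move=> d0 sumu c.
have sumv : \sum_i v i = c * d by rewrite /c divfK.
have -> : (\sum_i v i) ^+ 2 / d = 2 * c * \sum_i v i - c ^+ 2 * \sum_i u i.
  by rewrite sumu sumv; field.
rewrite !mulr_sumr -!sumrB -!big_split /=.
by apply: eq_bigr => i _; ring.
Qed.

(** These weights turn the sum over the image of f, with the fractional weight
    r on its last value, into a sum over all indices. *)
Definition selection_weight (R : realFieldType) (N t : nat) (r : R)
    (f : 'I_t.+1 -> 'I_N) (i : 'I_N) : R :=
  \sum_(j < t.+1) (if (j < t)%N then 1 else r) * (f j == i)%:R.

Lemma sum_selection_weight (R : realFieldType) (N t : nat) (r : R)
    (f : 'I_t.+1 -> 'I_N) (g : 'I_N -> R) :
  \sum_i selection_weight R N t r f i * g i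
  = \sum_(j < t) g (f (widen_ord (leqnSn _) j)) + r * g (f ord_max).
Proof.
transitivity (\sum_(j < t.+1) (if (j < t)%N then 1 else r) * g (f j)).
  under eq_bigr do rewrite mulr_suml.
  rewrite exchange_big /=; apply: eq_bigr => j _.
  rewrite (bigD1 (f j)) //= eqxx mulr1 big1 ?addr0 // => i /negPf fji.
  by rewrite eq_sym fji mulr0 mul0r.
rewrite big_ord_recr /= ltnn; congr (_ + _).
by apply: eq_bigr => j _; rewrite ltn_ord mul1r.
Qed.

Lemma selection_weight_inj (R : realFieldType) (N t : nat) (r : R)
    (f : 'I_t.+1 -> 'I_N) (j : 'I_t.+1) : injective f ->
  selection_weight R N t r f (f j) = if (j < t)%N then 1 else r.
Proof.
move=> f_inj; rewrite /selection_weight (bigD1 j) //= eqxx mulr1 big1 ?addr0 //.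
by move=> k /negPf kj; rewrite (inj_eq f_inj) kj mulr0.
Qed.

Lemma sum_selection_weight_compl (R : realFieldType) (N t : nat) (r : R)
    (f : 'I_t.+1 -> 'I_N) :
  \sum_i (1 - selection_weight R N t r f i) = N%:R - (t%:R + r).
Proof.
have := sum_selection_weight R N t r f (fun=> 1).
rewrite sumr_const card_ord mulr1 => <-.
by rewrite sumrB sumr_const card_ord; under [in RHS]eq_bigr do rewrite mulr1.
Qed.

(** Each fully selected index has weight 1 and each unselected one has weight 0,
    so in the sum of w_i (1 - w_i) only the fractional index contributes, and
    it contributes r (1 - r). *)
Lemma selected_sum_identity (R : realFieldType) (N t : nat) (r d : R)
    (f : 'I_t.+1 -> 'I_N) (v : 'I_N -> R) :
  injective f -> d != 0 -> d = N%:R - (t%:R + r) ->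
  let c := (\sum_i v i) / d in
  \sum_i (v i - c * (1 - selection_weight R N t r f i)) ^+ 2
    + c ^+ 2 * (r * (1 - r))
  = 2 * c * (\sum_(j < t) v (f (widen_ord (leqnSn _) j)) + r * v (f ord_max))
    + (\sum_i v i ^+ 2 - (\sum_i v i) ^+ 2 / d).
Proof.
move=> f_inj d0 dE c; rewrite -(sum_selection_weight R N t r f v).
set w := selection_weight R N t r f.
(* The summation formula for the weights is applied to 1 - w itself. *)
have -> : r * (1 - r) = \sum_i w i * (1 - w i).
  rewrite sum_selection_weight /w selection_weight_inj //= ltnn big1 ?add0r //.
  by move=> j _; rewrite selection_weight_inj //= ltn_ord subrr.
have := sum_sqr_sub_scaled R 'I_N (fun i => 1 - w i) v d d0.
rewrite sum_selection_weight_compl -dE => /(_ erefl) /=.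
under [in X in _ + _ * X = _]eq_bigr do rewrite subKr.
by under [in X in _ = _ * X + _]eq_bigr do rewrite subKr.
Qed.

Lemma sigma1E (R : realType) (N : nat) (V : 'rV[R]_N) :
  sigma 1 V = mubar V.
Proof.
rewrite /sigma (big_cards1 _ (fun A => \prod_(i in A) V 0 i)).
by apply: eq_bigr => i _; rewrite big_set1.
Qed.

(** Expand the square of the sum over ordered pairs: the diagonal gives the sum
    of squares, and each set of two indices comes from exactly two pairs. *)
Lemma sigma2E (R : realType) (N : nat) (V : 'rV[R]_N) :
  2 * sigma 2 V = mubar V ^+ 2 - \sum_i V 0 i ^+ 2.
Proof.
rewrite expr2 /mubar mulr_suml.
under eq_bigr do rewrite mulr_sumr.
rewrite pair_big /= (bigID (fun p => p.1 == p.2)) /=.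
have -> : \sum_(p : 'I_N * 'I_N | p.1 == p.2) V 0 p.1 * V 0 p.2
          = \sum_i V 0 i ^+ 2.
  rewrite (reindex (fun i => (i, i))) /=.
    by rewrite big_mkcond /=; apply: eq_bigr => i _; rewrite eqxx expr2.
  by exists fst => [//|[i j]]; rewrite inE /= => /eqP ->.
rewrite addrAC subrr add0r.
(* Group the off-diagonal pairs by their underlying set of two indices. *)
rewrite (partition_big (fun p => [set p.1; p.2]%SET) (fun A => #|A| == 2)) /=;
  last by move=> [i j] /= ij; rewrite cards2 ij.
rewrite mulr_sumr; apply: eq_bigr => A /cards2P [a [b [ab ->]]].
rewrite big_setU1 ?inE //= big_set1.
rewrite (bigD1 (a, b)) /= ?ab ?eqxx //.
rewrite (bigD1 (b, a)) /=; last first.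
  by rewrite [b == a]eq_sym ab finset.setUC eqxx /= xpair_eqE [b == a]eq_sym (negPf ab).
rewrite big1 ?addr0; first by ring.
move=> [i j] /= /andP[/andP[/andP[ij /eqP E] nab] nba].
have : i \in [set a; b]%SET by rewrite -E !inE eqxx.
have : j \in [set a; b]%SET by rewrite -E !inE eqxx orbT.
rewrite !inE => /orP[]/eqP jE /orP[]/eqP iE; move: ij nab nba;
  by rewrite iE jE ?eqxx.
Qed.

(** The shift multiplies the sum of the entries by eps, and lowers the sum of
    their squares by (1 - eps^2) / N times the square of their sum; positivity
    of sigma_1 and sigma_2 of the shifted vector then reads as stated. *)
Lemma Garding_cone_alpha_sum_sqr (R : realType) (N : nat) (eps : R)
    (V : 'rV[R]_N) : (0 < N)%N -> 0 < eps ->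
  Garding_cone_alpha N 2 (N%:R^-1 * (1 - eps)) V ->
  0 < mubar V /\
  N%:R * \sum_i V 0 i ^+ 2 < mubar V ^+ 2 * (1 + (N%:R - 1) * eps ^+ 2).
Proof.
move=> N0 eps0 cone_V; set alpha := _ * _ in cone_V.
have Np : 0 < N%:R :> R by rewrite ltr0n.
have mubarE : mubar (Valpha alpha V) = eps * mubar V.
  rewrite /mubar; under eq_bigr do rewrite !mxE.
  rewrite sumrB sumr_const card_ord -mulr_natr /alpha -/(mubar V).
  by field; rewrite gt_eqF.
have := cone_V 2%N isT; have := cone_V 1%N isT.
rewrite sigma1E mubarE pmulr_rgt0 // => s0 sigma2_gt0; split=> //.
have : 0 < N%:R * (2 * sigma 2 (Valpha alpha V)) by rewrite !mulr_gt0.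
rewrite sigma2E mubarE.
have -> : \sum_i Valpha alpha V 0 i ^+ 2
    = \sum_i V 0 i ^+ 2 - N%:R^-1 * (1 - eps ^+ 2) * mubar V ^+ 2.
  under eq_bigr do rewrite !mxE sqrrB.
  rewrite big_split /= sumrB sumr_const card_ord sumrMnl -mulr_suml.
  rewrite -/(mubar V) -[X in _ + X]mulr_natr /alpha.
  by field; rewrite gt_eqF.
rewrite -[_ < _ * (1 + _)]subr_gt0.
suff -> : N%:R * ((eps * mubar V) ^+ 2
    - (\sum_i V 0 i ^+ 2 - N%:R^-1 * (1 - eps ^+ 2) * mubar V ^+ 2))
  = mubar V ^+ 2 * (1 + (N%:R - 1) * eps ^+ 2) - N%:R * \sum_i V 0 i ^+ 2.
  by [].
by field; rewrite gt_eqF.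
Qed.

Lemma continuous_sum (R : realType) (T : topologicalType) (I : finType)
    (g : I -> T -> R) :
  (forall i, continuous (g i)) -> continuous (fun x => \sum_i g i x).
Proof.
move=> g_cont.
elim: (index_enum _) => [|i s IHs].
  by under eq_fun do rewrite big_nil; exact: cst_continuous.
under eq_fun do rewrite big_cons.
by move=> x; apply: continuousD; [exact: g_cont|exact: IHs].
Qed.

Lemma closure_Garding_cone_alpha_sum_sqr (R : realType) (N : nat) (eps : R)
    (V : 'rV[R]_N) : (0 < N)%N -> 0 < eps ->
  closure (Garding_cone_alpha N 2 (N%:R^-1 * (1 - eps))) V ->
  N%:R * \sum_i V 0 i ^+ 2 <= mubar V ^+ 2 * (1 + (N%:R - 1) * eps ^+ 2).
Proof.
move=> N0 eps0; set D := 1 + _ * _.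
pose g (U : 'rV[R]_N) := mubar U * mubar U * D - N%:R * \sum_i U 0 i * U 0 i.
have entry_cont i : continuous (fun U : 'rV[R]_N => U 0 i).
  exact: coord_continuous.
have mubar_cont : continuous (@mubar R N) by exact: continuous_sum.
have sqr_cont (h : 'rV[R]_N -> R) : continuous h ->
    continuous (fun U => h U * h U).
  by move=> h_cont U; apply: continuousM; exact: h_cont.
have g_cont : continuous g.
  move=> U; apply: (@continuousB _ _ _ (fun U => mubar U * mubar U * D)
    (fun U => N%:R * \sum_i U 0 i * U 0 i)).
    by apply: continuousM; [exact: sqr_cont|exact: cst_continuous].
  apply: continuousM; first exact: cst_continuous.
  apply: (continuous_sum R _ _ (fun i (W : 'rV[R]_N) => W 0 i * W 0 i)).
  by move=> i; exact: sqr_cont.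
have gE U : g U = mubar U ^+ 2 * D - N%:R * \sum_i U 0 i ^+ 2 by [].
have closed_g : closed (g @^-1` [set x | 0 <= x]).
  by apply: preimage_closed; [move=> U _; exact: g_cont|exact: closed_ge].
move=> clV; rewrite -subr_ge0 -gE.
apply: closed_g; apply: closureS clV => U coneU /=.
have [_ lt_qs] := Garding_cone_alpha_sum_sqr R N eps U N0 eps0 coneU.
by rewrite gE subr_ge0 ltW.
Qed.

Theorem theorem1p1 (R : realType) (N : nat) (hN : (2 <= N)%N)
    (eps : R) (heps0 : 0 < eps) (heps1 : eps < 1) :
  let alpha : R := N%:R^-1 * (1 - eps) in
  let m : R := N%:R * (N%:R - 1) * eps ^+ 2 / (1 + (N%:R - 1) * eps ^+ 2) in
  closure (Garding_cone_alpha N 2 alpha) `<=` closure (Pcone N m)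
  /\
  forall V : 'rV[R]_N,
    closure (Garding_cone_alpha N 2 alpha) V ->
    (forall i j : 'I_N, (i <= j)%N -> V 0 i <= V 0 j) ->
    0 < mubar V ->
    0 < \sum_(0 <= i < Num.truncn m) entry V i
        + (m - (Num.truncn m)%:R) * entry V (Num.truncn m)
    \/
    exists k : nat,
      [/\ (0 < k)%N, m = k%:R,
          forall i : 'I_N, (i < k)%N -> V 0 i = 0
        & exists c : R, 0 < c /\ forall i : 'I_N, (k <= i)%N -> V 0 i = c].
Proof.
move=> alpha m; rewrite {}/alpha.
have N0 : (0 < N)%N by exact: ltnW.
have Np : 0 < N%:R :> R by rewrite ltr0n.
have N1p : 0 < N%:R - 1 :> R by rewrite subr_gt0 ltr1n.
pose D : R := 1 + (N%:R - 1) * eps ^+ 2.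
have Dp : 0 < D by rewrite addr_gt0 // mulr_gt0 // exprn_gt0.
pose d := N%:R / D.
have dp : 0 < d by rewrite divr_gt0.
have mE : m = N%:R - d by rewrite /m /d -/D /D; field; rewrite gt_eqF.
have mp : 0 < m by rewrite divr_gt0 // !mulr_gt0 ?exprn_gt0.
have [tm mt] := andP (truncn_itv (ltW mp)).
set t := Num.truncn m in tm mt *; set r := m - t%:R.
have r0 : 0 <= r by rewrite subr_ge0.
have r1 : 0 < 1 - r by rewrite /r; move: mt; rewrite -natr1; lra.
have dE : d = N%:R - (t%:R + r) by rewrite /r subrKC mE subKr.
have quadE q (s : R) : q - s ^+ 2 / d = (N%:R * q - s ^+ 2 * D) / N%:R.
  by rewrite /d; field; rewrite !gt_eqF.
split.
  apply: closureS => V /(Garding_cone_alpha_sum_sqr R N eps V N0 heps0) [s0 qlt] f f_inj.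
  have := selected_sum_identity R N t r d f (V 0) f_inj (lt0r_neq0 dp) dE.
  rewrite quadE /= -/(mubar V); set c := mubar V / d.
  have c0 : 0 < c by rewrite divr_gt0.
  set S := \sum_(j < t) _ + _; set Q := (_ - _) / _.
  have Q0 : Q < 0 by rewrite pmulr_llt0 ?invr_gt0 // subr_lt0.
  have sq_ge0 : 0 <= \sum_i (V 0 i - c * (1 - selection_weight R N t r f i)) ^+ 2.
    by apply: sumr_ge0 => i _; exact: sqr_ge0.
  have cr_ge0 : 0 <= c ^+ 2 * (r * (1 - r)).
    by rewrite mulr_ge0 ?sqr_ge0 // mulr_ge0 // ltW.
  move=> E; rewrite -/r -/S.
  have : 0 < 2 * c * S by lra.
  by rewrite pmulr_rgt0 // mulr_gt0.
move=> V clV _ s0.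
have qle := closure_Garding_cone_alpha_sum_sqr R N eps V N0 heps0 clV.
have tN : (t < N)%N.
  by rewrite -(ltr_nat R); apply: le_lt_trans tm _; rewrite mE gtrBl.
pose f := widen_ord tN.
have f_inj : injective f by move=> i j /(congr1 val) /= ?; exact: val_inj.
have := selected_sum_identity R N t r d f (V 0) f_inj (lt0r_neq0 dp) dE.
rewrite quadE /= -/(mubar V); set c := mubar V / d.
have c0 : 0 < c by rewrite divr_gt0.
have entryE (k : 'I_t.+1) : entry V k = V 0 (f k).
  have kN : (k < N)%N := leq_trans (ltn_ord k) tN.
  by rewrite /entry (insubT (fun i => i < N)%N kN) /=; congr (V 0 _); exact: val_inj.
have -> : \sum_(j < t) V 0 (f (widen_ord (leqnSn t) j)) + r * V 0 (f ord_max)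
    = \sum_(0 <= i < t) entry V i + r * entry V t.
  rewrite big_mkord -(entryE ord_max); congr (_ + _).
  by apply: eq_bigr => j _; rewrite -entryE.
set S := \sum_(0 <= i < t) _ + _; set Q := (_ - _) / _.
have Q0 : Q <= 0 by rewrite pmulr_lle0 ?invr_gt0 // subr_le0.
set w := selection_weight R N t r f.
have sq_ge0 i : true -> 0 <= (V 0 i - c * (1 - w i)) ^+ 2.
  by move=> _; exact: sqr_ge0.
have sum_ge0 : 0 <= \sum_i (V 0 i - c * (1 - w i)) ^+ 2 by exact: sumr_ge0.
have cr_ge0 : 0 <= c ^+ 2 * (r * (1 - r)) by rewrite mulr_ge0 ?sqr_ge0 // mulr_ge0 // ltW.
move=> E; have [S0|S0] := ltP 0 S; [by left|right].
have cS : 2 * c * S <= 0 by rewrite pmulr_rle0 // mulr_gt0.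
(* The right-hand side of E is nonpositive, so each defect on the left is 0. As
   r < 1, the vanishing of r (1 - r) leaves only r = 0. *)
have r_eq0 : r = 0.
  have /eqP : c ^+ 2 * (r * (1 - r)) = 0 by lra.
  by rewrite mulf_eq0 sqrf_eq0 (gt_eqF c0) mulf_eq0 (gt_eqF r1) orbF => /eqP.
have VE i : V 0 i = c * (1 - w i).
  have /(psumr_eq0P sq_ge0) /(_ i isT) /eqP : 
    \sum_i (V 0 i - c * (1 - w i)) ^+ 2 = 0 by lra.
  by rewrite expf_eq0 /= subr_eq0 => /eqP.
have m_eq : m = t%:R by apply/eqP; rewrite -subr_eq0 -/r r_eq0.
exists t; split=> //.
- by rewrite -(ltr0n R) -m_eq.
- move=> i it.
  have -> : i = f (Ordinal (ltnW it : (i < t.+1)%N)) by exact: val_inj.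
  by rewrite VE /w selection_weight_inj //= it subrr mulr0.
- exists c; split=> // i ti.
  rewrite VE /w /selection_weight r_eq0 big1 ?subr0 ?mulr1 // => j _.
  case: ltnP => [jt|_]; last by rewrite mul0r.
  rewrite -val_eqE /= ltn_eqF ?mulr0 //.
  exact: leq_trans jt ti.
Qed.
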